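(* Let $\Gamma$ be a tree on a finite set $\Pi$ and let $\{\Pi_1,\Pi_2\}$ be a principal decomposition of $\Gamma$. Then $$\sigma(\Gamma)=(\#\Pi)!\sum_{\tilde d\in\widetilde{Ord}(\Pi_1)}\frac{1}{\prod_{v\in\Pi_1}\#\Gamma_{d,v}},$$ where for each class $\tilde d$ a representative $d$ is chosen (the summand depends only on $\tilde d$), and $\#\Gamma_{d,v}$ denotes the number of vertices of $\Gamma_{d,v}$.
   Context: $\Gamma$ is a tree with vertex set $\Pi$. An acyclic orientation $o$ of $\Gamma$ assigns a direction $\alpha<_o\beta$ to each edge (trees have no cycles, so every orientation is acyclic); $Or(\Gamma)$ is the set of orientations. $\sigma(o)$ is the number of linear orderings $c$ of $\Pi$ such that $\alpha<_c\beta$ for every edge oriented $\alpha<_o\beta$ (equivalently the number of type $A_{l-1}$ chambers in the corresponding $\Gamma$-cone in the configuration space $V_\Pi$), and $\sigma(\Gamma):=\max_{o\in Or(\Gamma)}\sigma(o)$. A principal decomposition is an ordered pair $\{\Pi_1,\Pi_2\}$ with $\Pi=\Pi_1\sqcup\Pi_2$ such that no edge joins two vertices of the same $\Pi_i$. For a linear ordering $d$ of $\Pi_1$ and $v\in\Pi_1$, let $\Gamma_{d,v}$ be the connected component containing $v$ of the subgraph of $\Gamma$ induced on $\Pi\setminus\{w\in\Pi_1\mid w<_dv\}$. Two linear orderings $d,d'$ of $\Pi_1$ are equivalent if $\Gamma_{d,v}=\Gamma_{d',v}$ for all $v\in\Pi_1$; $\widetilde{Ord}(\Pi_1)$ denotes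 the set of equivalence classes $\tilde d$. *)

(* Defs.v *)
From mathcomp Require Import all_boot all_order all_algebra.

Set Implicit Arguments.
Unset Strict Implicit.
Unset Printing Implicit Defensive.

(* A graph on the vertex set T is given by its adjacency relation e : rel T.  *)
(* Orientations and strict linear orderings are sets of ordered pairs, with   *)
(* (x, y) in the set meaning x < y; this makes them finite types.             *)

Section Trees.

Variables (T : finType) (e : rel T).

(* The empty graph is not excluded. *)
Definition is_tree : Prop :=
  [/\ symmetric e, irreflexive e, forall x y : T, connect e x y &
      forall c : seq T, cycle e c -> uniq c -> size c <= 2].

Definition principal_decomposition (P1 P2 : {set T}) : Prop :=
  [/\ P1 :|: P2 = [set: T], [disjoint P1 & P2],
      {in P1 &, forall x y, ~~ e x y} & {in P2 &, forall x y, ~~ e x y}].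

Definition is_orientation (o : {set T * T}) : bool :=
  [forall p in o, e p.1 p.2] &&
  [forall x, forall y, e x y ==> (((x, y) \in o) (+) ((y, x) \in o))].

Definition is_acyclic (o : {set T * T}) : bool :=
  [forall p in o, ~~ connect [rel x y | (x, y) \in o] p.2 p.1].

Definition orientations : {set {set T * T}} :=
  [set o | is_orientation o && is_acyclic o].

Definition is_linear_order (A : {set T}) (c : {set T * T}) : bool :=
  [&& c \subset setX A A,
      [forall x, (x, x) \notin c],
      [forall x, forall y, forall z,
        ((x, y) \in c) ==> ((y, z) \in c) ==> ((x, z) \in c)] &
      [forall x in A, forall y in A,
        (x != y) ==> ((x, y) \in c) || ((y, x) \in c)]].

Definition linear_orders (A : {set T}) : {set {set T * T}} :=
  [set c | is_linear_order A c].

Definition sigma_orientation (o : {set T * T}) : nat :=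
  #|[set c in linear_orders [set: T] | o \subset c]|.

Definition sigma : nat := \max_(o in orientations) sigma_orientation o.

(* Meaningful for v \in S. *)
Definition component_in (S : {set T}) (v : T) : {set T} :=
  [set u | connect [rel x y | [&& x \in S, y \in S & e x y]] v u].

(* Gamma_{d,v} is an induced subgraph, hence it is determined by its set of   *)
(* vertices, by which it is represented.                                      *)
Definition Gamma_ (P1 : {set T}) (d : {set T * T}) (v : T) : {set T} :=
  component_in ([set: T] :\: [set w in P1 | (w, v) \in d]) v.

Definition ord_equiv (P1 : {set T}) : rel {set T * T} :=
  fun d d' => [forall v in P1, Gamma_ P1 d v == Gamma_ P1 d' v].

Lemma ord_equiv_rel (P1 : {set T}) :
  {in linear_orders P1 & &, equivalence_rel (ord_equiv P1)}.
Proof.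
move=> d1 d2 d3 _ _ _; split; first by apply/forall_inP=> v _.
move=> /forall_inP E12; apply/forall_inP/forall_inP=> E v vP1.
  by rewrite -(eqP (E12 v vP1)) E.
by rewrite (eqP (E12 v vP1)) E.
Qed.

Definition ord_classes (P1 : {set T}) : {set {set {set T * T}}} :=
  equivalence_partition (ord_equiv P1) (linear_orders P1).

End Trees.

(* Main.v *)
Require Import Defs.
From mathcomp Require Import all_boot all_order all_algebra.
From mathcomp Require Import zify.

Set Implicit Arguments.
Unset Strict Implicit.
Unset Printing Implicit Defensive.

(* The maximum is attained at the alternating orientation, in which every edge
   goes from P1 to P2. To compare it with an orientation o, count the maps
   T -> [m] that increase strictly along o, each vertex v carrying a weight
   P_v(x) Q_v(m-1-x) with P_v and Q_v nonincreasing. Summing over the value at a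
   leaf multiplies the weight of its neighbour by a partial sum, which by a
   Chebyshev inequality is at most the partial sum of P_v Q_v taken from the end
   that the alternating orientation uses; so by induction the alternating
   orientation has the largest count. As m grows, almost all these maps are
   injective, and the injective ones number sigma(o) * C(m, #T).

   A linear order c extends the alternating orientation and restricts to an
   order of P1 equivalent to d if and only if every v in P1 is the c-minimum of
   Gamma_{d,v}. The sets Gamma_{d,v} form a laminar family, so these c are
   counted by the hook length formula for forests, proved by removing the
   minimum. *)

(** * Chebyshev-type inequalities for truncated sums *)

Definition nonincreasing m (P : 'I_m -> nat) : Prop :=
  forall i j : 'I_m, i <= j -> P j <= P i.

(** Indices [y < t] whose reversal is also below [t] form a set stable under reversal, and for [y]
    and [rev_ord y] together this is the rearrangement inequality. The remaining indices satisfy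
    [y < t <= rev_ord y], so there the terms compare one by one. *)
Lemma sum_mul_rev_le m (P Q : 'I_m -> nat) (t : nat) :
  nonincreasing P -> nonincreasing Q ->
  \sum_(y < m | y < t) P y * Q (rev_ord y) <= \sum_(y < m | y < t) P y * Q y.
Proof.
move=> Pd Qd; rewrite (bigID (fun y : 'I_m => rev_ord y < t)) /=.
rewrite [leqRHS](bigID (fun y : 'I_m => rev_ord y < t)) /=; apply: leq_add.
  set B := fun y : 'I_m => (y < t) && (rev_ord y < t).
  have BE (F : 'I_m -> nat) :
      \sum_(y | B y) F (rev_ord y) = \sum_(y | B y) F y.
    rewrite [RHS](reindex_inj rev_ord_inj) /=; apply: eq_bigl => y.
    by rewrite /B rev_ordK andbC.
  (* Doubling both sides groups [y] with [rev_ord y] without choosing one index from each pair. *)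
  rewrite -leq_double -!addnn -{2}BE -{2}(BE (fun y => P y * Q y)) -!big_split.
  apply: leq_sum => y _ /=; rewrite rev_ordK.
  case/orP: (leq_total y (rev_ord y)) => le_y; have := (Pd _ _ le_y, Qd _ _ le_y);
    move: (P y) (P (rev_ord y)) (Q y) (Q (rev_ord y)) => a a' b b' [/= la lb]; nia.
apply: leq_sum => y /andP[yt]; rewrite -leqNgt => ty.
by rewrite leq_mul2l Qd ?orbT // ltnW // (leq_trans yt).
Qed.

(** Reversal turns the upper tail into an initial segment and exchanges the roles of [P] and [Q]. *)
Lemma sum_mul_rev_gt m (P Q : 'I_m -> nat) (t : 'I_m) :
  nonincreasing P -> nonincreasing Q ->
  \sum_(y < m | t < y) P y * Q (rev_ord y) <=
  \sum_(y < m | y < rev_ord t) P y * Q y.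
Proof.
move=> Pd Qd; rewrite (reindex_inj rev_ord_inj) /=.
rewrite (eq_bigl (fun y : 'I_m => y < rev_ord t)); last first.
  by move=> y /=; case: y t => y ym [t tm] /=; lia.
under eq_bigr do rewrite rev_ordK mulnC.
by under [leqRHS]eq_bigr do rewrite mulnC; apply: sum_mul_rev_le.
Qed.

(** * Changing a map at one point *)

Section Update.
Variables (T U : finType).

Definition update (f : {ffun T -> U}) (w : T) (y : U) : {ffun T -> U} :=
  [ffun x => if x == w then y else f x].

Lemma update_same f w y : update f w y w = y.
Proof. by rewrite ffunE eqxx. Qed.

Lemma update_other f w y x : x != w -> update f w y x = f x.
Proof. by rewrite ffunE => /negPf->. Qed.

(** Exchanging [y] with [f w] is an involution on the pairs [(f, y)]; after it the summand depends
    on the map alone. *)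
Lemma sum_update (H : {ffun T -> U} -> nat) (w : T) :
  \sum_f \sum_y H (update f w y) = #|U| * \sum_f H f.
Proof.
pose h (p : {ffun T -> U} * U) := (update p.1 w p.2, p.1 w).
have hK : involutive h.
  case=> f y; rewrite /h /= update_same; congr pair.
  by apply/ffunP=> x; rewrite !ffunE; case: eqP => // ->.
rewrite pair_bigA (reindex_inj (inv_inj hK)) /=.
rewrite (eq_bigr (fun p => H p.1)) => [|p _]; last first.
  by rewrite -[in RHS](hK p).
rewrite -(pair_bigA _ (fun f _ => H f)) /=.
by under eq_bigr do rewrite sum_nat_const; rewrite -big_distrr.
Qed.

End Update.

(** * Leaves in a graph without cycles *)

Section Elimination.
Variables (T : finType) (e : rel T).
Hypotheses (e_sym : symmetric e) (e_irr : irreflexive e).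
Hypothesis e_acyc : forall c : seq T, cycle e c -> uniq c -> size c <= 2.

(** If every vertex of [S] had two neighbours in [S], there would be simple paths in [S] of every
    length, and one with [#|T|] edges has too many vertices. The vertex found may also be isolated
    in [S]. *)
Lemma exists_leaf (S : {set T}) : S != set0 ->
  exists2 w, w \in S & {in S &, forall a b, e w a -> e w b -> a = b}.
Proof.
case/set0Pn=> s0 s0S.
case: (boolP [exists w in S, [forall a in S, forall b in S,
         e w a ==> e w b ==> (a == b)]]) => [/exists_inP[w wS]|].
  move=> /forall_inP H; exists w => // a b aS bS wa wb.
  by move/forall_inP: (H a aS) => /(_ b bS); rewrite wa wb => /eqP.
move=> /exists_inPn no_leaf.
(* Prepending to a path a neighbour of its head other than the next vertex never
   closes up, as there are no cycles. *)
have long n : exists x p, [/\ path e x p, uniq (x :: p),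
    {subset x :: p <= S} & size p = n].
  elim: n => [|n [x [p [xp up pS sp]]]].
    by exists s0, [::]; split=> // y; rewrite inE => /eqP->.
  have xS : x \in S by apply: pS; rewrite mem_head.
  have [a [aS xa ap]] : exists a, [/\ a \in S, e x a & (p == [::]) || (a != head a p)].
    have /forall_inPn[a aS /forall_inPn[b bS]] := no_leaf x xS.
    rewrite !negb_imply => /and3P[xa xb ab].
    case: p {xp up pS sp} => [|z p] /=; first by exists a.
    case: (eqVneq a z) ab => [->|az _]; last by exists a.
    by rewrite eq_sym => bz; exists b; rewrite bz.
  have ax : a != x by apply: contraTneq xa => ->; rewrite e_irr.
  case: (boolP (a \in p)) => [|aNp]; last first.
    exists a, (x :: p); split=> /=; rewrite ?sp //.
    - by rewrite e_sym xa.
    - by rewrite inE negb_or ax aNp.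
    - by move=> y; rewrite inE => /orP[/eqP->//|/pS].
  move=> /splitPr ap'; case: ap' up xp ap {pS sp} => [[|z p1] p2].
    by rewrite /= eqxx.
  move=> up xp _; have : size (x :: z :: rcons p1 a) <= 2; last by rewrite /= size_rcons.
  apply: e_acyc.
  - move: xp; rewrite /= rcons_path last_rcons (e_sym a) xa andbT rcons_path.
    by rewrite cat_path => /and3P[-> -> /andP[->]].
  - move: up; rewrite -cat_rcons.
    by rewrite -[x :: _]/((x :: z :: rcons p1 a) ++ p2) cat_uniq => /andP[].
have [x [p [_ up _ sp]]] := long #|T|.
by have := card_uniqP up => /= E; have := max_card (mem (x :: p)); rewrite E /= sp ltnn.
Qed.

End Elimination.

(** * Weighted counts of increasing maps and the removal of a vertex *)

Section WeightedCount.
Variables (T : finType) (m : nat).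
Implicit Types (S : {set T}) (o : {set T * T}) (f : {ffun T -> 'I_m}).

Definition increasing_on S o f : bool :=
  [forall p in o, (p.1 \in S) ==> (p.2 \in S) ==> (f p.1 < f p.2)].

Lemma increasing_onP S o f :
  reflect {in S &, forall x y, (x, y) \in o -> f x < f y} (increasing_on S o f).
Proof.
apply: (iffP forall_inP) => [H x y xS yS xy | H [x y] xy /=].
  by have:= H _ xy; rewrite xS yS.
by apply/implyP=> xS; apply/implyP=> yS; apply: H.
Qed.

(* Maps stay defined on all of T, so dropping a vertex from S multiplies the
   count by m. *)
Definition weighted_count S o (W : T -> 'I_m -> nat) : nat :=
  \sum_f increasing_on S o f * \prod_(v in S) W v (f v).

Definition compatible S o f (w : T) (y : 'I_m) : bool :=
  [forall v in S :\ w,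
     (((v, w) \in o) ==> (f v < y)) && (((w, v) \in o) ==> (y < f v))].

Lemma increasing_on_update S o f w y : w \in S -> (w, w) \notin o ->
  increasing_on S o (update f w y) =
  increasing_on (S :\ w) o f && compatible S o f w y.
Proof.
move=> wS wo; apply/increasing_onP/andP => [H | [/increasing_onP H /forall_inP C]].
  split.
    apply/increasing_onP => a b /setD1P[aw aS] /setD1P[bw bS] ab.
    by have := H a b aS bS ab; rewrite !update_other.
  apply/forall_inP => v /setD1P[vw vS].
  apply/andP; split; apply/implyP => vo.
    by have := H v w vS wS vo; rewrite update_same update_other.
  by have := H w v wS vS vo; rewrite update_same update_other.
move=> a b aS bS ab; case: (eqVneq a w) (eqVneq b w) => [aw|aw] [bw|bw].
- by rewrite aw bw (negPf wo) in ab.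
- have bSw : b \in S :\ w by rewrite !inE bw.
  have /andP[_] := C b bSw; rewrite -[X in (X, b)]aw ab /=.
  by rewrite aw update_same update_other.
- have aSw : a \in S :\ w by rewrite !inE aw.
  have /andP[+ _] := C a aSw; rewrite -[X in (a, X)]bw ab /=.
  by rewrite bw update_same update_other.
- by rewrite !update_other //; apply: H; rewrite // !inE ?aw ?bw.
Qed.

(** By [sum_update] the value at [w] can be drawn anew, independently of [f]; the factor [m] counts
    the values [f w], which no longer matter. *)
Lemma weighted_count_eliminate S o W w : w \in S -> (w, w) \notin o ->
  m * weighted_count S o W =
  \sum_f increasing_on (S :\ w) o f * \prod_(v in S :\ w) W v (f v) *
    \sum_(y | compatible S o f w y) W w y.
Proof.
move=> wS wo; rewrite /weighted_count -{1}(card_ord m) -(sum_update _ w).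
apply: eq_bigr => f _; rewrite big_distrr [RHS]big_mkcond /=.
apply: eq_bigr => y _; rewrite increasing_on_update // (big_setD1 w) //=.
rewrite update_same (eq_bigr (fun v => W v (f v))); last first.
  by move=> v /setD1P[vw _]; rewrite update_other.
by case: increasing_on; case: compatible; rewrite ?mul0n ?muln0 ?mul1n // mulnC.
Qed.

Lemma weighted_count_isolated S o W w :
  w \in S -> {in S, forall a, ((a, w) \notin o) && ((w, a) \notin o)} ->
  m * weighted_count S o W = (\sum_y W w y) * weighted_count (S :\ w) o W.
Proof.
move=> wS H; have /andP[wo _] := H w wS.
rewrite (weighted_count_eliminate W wS wo) big_distrr /=; apply: eq_bigr => f _.
rewrite mulnC; congr (_ * _); apply: eq_bigl => y; apply/forall_inP => v.
by move=> /setD1P[_ vS]; have /andP[/negPf-> /negPf->] := H v vS.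
Qed.

Definition absorb (W : T -> 'I_m -> nat) (v : T) (K : 'I_m -> nat) :=
  fun u x => W u x * (if u == v then K x else 1).

(** Since [v] is the only vertex of [S] comparable with [w], the sum over the value at [w] is a
    function of [f v] and can be moved into the weight of [v]. *)
Lemma weighted_count_leaf S o W v w :
  v \in S -> w \in S -> v != w -> (w, w) \notin o ->
  ((w, v) \in o) = ((v, w) \notin o) ->
  {in S, forall a, a != v -> ((a, w) \notin o) && ((w, a) \notin o)} ->
  m * weighted_count S o W =
  weighted_count (S :\ w) o
    (absorb W v (fun x => \sum_(y : 'I_m | if (v, w) \in o then x < y else y < x) W w y)).
Proof.
move=> vS wS vw wo wv H; rewrite (weighted_count_eliminate W wS wo).
have vSw : v \in S :\ w by rewrite !inE vw.
apply: eq_bigr => f _; rewrite /absorb big_split /= -mulnA; congr (_ * (_ * _)).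
rewrite [RHS](big_setD1 v) //= eqxx [X in _ * X]big1 ?muln1; last first.
  by move=> u /setD1P[/negPf->].
apply: eq_bigl => y; apply/forall_inP/idP => [/(_ v vSw)|C u].
  by rewrite wv; case: ifP => _; rewrite ?andbT.
case: (eqVneq u v) => [-> _|uv /setD1P[_ uS]].
  by rewrite wv; case: ifP C => //= _ ->.
by have /andP[/negPf-> /negPf->] := H u uS uv.
Qed.

Lemma leq_weighted_count S o W W' : (forall v x, W v x <= W' v x) ->
  weighted_count S o W <= weighted_count S o W'.
Proof.
by move=> le; apply: leq_sum => f _; rewrite leq_mul2l leq_prod ?orbT.
Qed.

Lemma eq_weighted_count S o W W' : (forall v x, W v x = W' v x) ->
  weighted_count S o W = weighted_count S o W'.
Proof.
by move=> E; apply: eq_bigr => f _; congr (_ * _); apply: eq_bigr => v _; apply: E.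
Qed.

End WeightedCount.

(** * Comparison with the alternating orientation *)

Lemma is_orientationP (T : finType) (e : rel T) (o : {set T * T}) :
  symmetric e -> is_orientation e o ->
  (forall x y, (x, y) \in o -> e x y) /\
  (forall x y, e x y -> ((y, x) \in o) = ((x, y) \notin o)).
Proof.
move=> e_sym /andP[/forall_inP oe /forallP oX]; split=> [x y /oe //|x y xy].
by have /forallP/(_ y) := oX x; rewrite xy /=; case: (_ \in o); case: (_ \in o).
Qed.

Section AlternatingIsMaximal.
Variables (T : finType) (e : rel T) (P1 P2 : {set T}).
Hypotheses (e_sym : symmetric e) (e_irr : irreflexive e).
Hypothesis e_acyc : forall c : seq T, cycle e c -> uniq c -> size c <= 2.
Hypothesis P12 : principal_decomposition e P1 P2.

Definition alternating : {set T * T} :=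
  [set p | [&& e p.1 p.2, p.1 \in P1 & p.2 \in P2]].

Lemma P2E x : (x \in P2) = (x \notin P1).
Proof.
have [/setP/(_ x) U D _ _] := P12; move: U; rewrite !inE.
by case: (boolP (x \in P1)) => [xP _|//]; rewrite (disjointFr D xP).
Qed.

Lemma edgeP1 x y : e x y -> (y \in P1) = (x \notin P1).
Proof.
have [_ _ I1 I2] := P12; move=> xy.
case: (boolP (x \in P1)) => xP; case: (boolP (y \in P1)) => // yP.
  by have := I1 x y xP yP; rewrite xy.
by have := I2 x y; rewrite !P2E xP yP xy => /(_ isT isT).
Qed.

Lemma alternatingE x y : e x y -> ((x, y) \in alternating) = (x \in P1).
Proof.
by move=> xy; rewrite inE /= xy P2E (edgeP1 xy) negbK andbb.
Qed.

Lemma alternating_orientation : alternating \in orientations e.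
Proof.
rewrite inE; apply/andP; split; [apply/andP; split|].
- by apply/forall_inP=> p; rewrite inE => /and3P[].
- apply/forallP=> x; apply/forallP=> y; apply/implyP=> xy.
  by rewrite !alternatingE // 1?e_sym // (edgeP1 xy); case: (x \in P1).
(* Arcs end in [P2] and none starts there, so no path leads back. *)
apply/forall_inP=> -[x y]; rewrite inE /= => /and3P[xy xP yP].
apply/connectP=> -[[|z p]] /=; first by move=> _ E; rewrite -E e_irr in xy.
by rewrite inE /= andbA => /andP[/andP[/andP[_ y1] _] _]; rewrite P2E y1 in yP.
Qed.

(** Composed with [reflect2 v], a nonincreasing weight favours small values on [P1] and large ones
    on [P2], as the alternating orientation does. *)
Definition reflect2 m (v : T) (x : 'I_m) : 'I_m :=
  if v \in P1 then x else rev_ord x.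

(** General weights are needed for the induction on [#|S|]: removing a leaf makes the weight of its
    neighbour nonconstant. The sum over the leaf is bounded by a monotone function of the
    neighbour's value, so the new weight again has the form of a [P] factor times a reversed [Q]
    factor. *)
Lemma weighted_count_le_alternating m o (S : {set T}) (P Q : T -> 'I_m -> nat) :
  0 < m -> o \in orientations e ->
  (forall v, nonincreasing (P v)) -> (forall v, nonincreasing (Q v)) ->
  weighted_count S o (fun v x => P v x * Q v (rev_ord x)) <=
  weighted_count S alternating
    (fun v x => P v (reflect2 v x) * Q v (reflect2 v x)).
Proof.
move=> m0 oE.
have [oe oX] : (forall x y, (x, y) \in o -> e x y) /\
  (forall x y, e x y -> ((y, x) \in o) = ((x, y) \notin o)).
  by apply: is_orientationP => //; move: oE; rewrite inE => /andP[].
have [ae aX] : (forall x y, (x, y) \in alternating -> e x y) /\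
  (forall x y, e x y -> ((y, x) \in alternating) = ((x, y) \notin alternating)).
  apply: is_orientationP => //; have := alternating_orientation.
  by rewrite inE => /andP[].
have [k] := ubnP #|S|; elim: k S P Q => // k IHk S P Q Sk Pd Qd.
case: (eqVneq S set0) => [->|/(exists_leaf e_sym e_irr e_acyc)[w wS leaf]].
  apply: leq_sum => f _; rewrite !big_set0 !muln1.
  suff -> : increasing_on set0 alternating f by case: increasing_on.
  by apply/increasing_onP => x y; rewrite inE.
have Swk : #|S :\ w| < k by rewrite (cardsD1 w) wS in Sk.
rewrite -(leq_pmul2l m0).
have wo : (w, w) \notin o by apply/negP => /oe; rewrite e_irr.
have wa : (w, w) \notin alternating by apply/negP => /ae; rewrite e_irr.
case: (boolP [exists v in S, e w v]) => [/exists_inP[v vS wv]|/exists_inPn noN];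
    last first.
  rewrite (weighted_count_isolated _ wS); last first.
    move=> a aS; have /negPf h := noN a aS.
    by apply/andP; split; apply/negP => /oe; rewrite ?(e_sym a) h.
  rewrite [leqRHS](weighted_count_isolated _ wS); last first.
    move=> a aS; have /negPf h := noN a aS.
    by apply/andP; split; apply/negP => /ae; rewrite ?(e_sym a) h.
  apply: leq_mul; last exact: IHk.
  have -> : \sum_(y < m) P w (reflect2 w y) * Q w (reflect2 w y) =
            \sum_(y < m) P w y * Q w y.
    rewrite /reflect2; case: (w \in P1) => //; by rewrite [RHS](reindex_inj rev_ord_inj).
  (* The full sum is the one truncated at [t = m]. *)
  have mE (y : 'I_m) : xpredT y = (y < m) by rewrite ltn_ord.
  rewrite (eq_bigl _ _ mE) [leqRHS](eq_bigl _ _ mE).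
  exact: sum_mul_rev_le.
have vw : v != w by apply: contraTneq wv => ->; rewrite e_irr.
have vwe : e v w by rewrite e_sym.
have uniqv a : a \in S -> a != v -> ~~ e w a.
  by move=> aS; apply: contra => wa'; apply/eqP/leaf.
rewrite (weighted_count_leaf _ vS wS vw wo (oX _ _ vwe)); last first.
  move=> a aS av; have /negPf h := uniqv a aS av.
  by apply/andP; split; apply/negP => /oe; rewrite ?(e_sym a) h.
rewrite [leqRHS](weighted_count_leaf _ vS wS vw wa (aX _ _ vwe)); last first.
  move=> a aS av; have /negPf h := uniqv a aS av.
  by apply/andP; split; apply/negP => /ae; rewrite ?(e_sym a) h.
(* If [v] precedes [w] in [o], the leaf sum at [x] is at most [G x]; otherwise it is at most
   [G (rev_ord x)]. *)
pose G (x : 'I_m) := \sum_(y < m | y < rev_ord x) P w y * Q w y.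
have Gd : nonincreasing G.
  move=> i j ij; rewrite /G [leqRHS](bigID (fun y : 'I_m => y < rev_ord j)) /=.
  apply: leq_trans (leq_addr _ _); rewrite leq_eqVlt; apply/orP; left; apply/eqP.
  by apply: eq_bigl => y; move: ij; case: i j y => i im [j jm] [y ym] /=; lia.
(* As [G] is nonincreasing, the bound [G x] goes into the [P] factor and the bound [G (rev_ord x)]
   into the [Q] factor, which is evaluated at [rev_ord x]. *)
pose P' := absorb P v (fun x => if (v, w) \in o then G x else 1).
pose Q' := absorb Q v (fun x => if (v, w) \in o then 1 else G x).
have absd R (b : bool) : (forall u, nonincreasing (R u)) ->
    forall u, nonincreasing (absorb R v (fun x => if b then G x else 1) u).
  move=> Rd u i j ij; apply: leq_mul; first exact: Rd.
  by case: ifP => // _; case: ifP => // _; apply: Gd.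
apply: leq_trans (leq_trans (IHk _ P' Q' Swk _ _) _).
- apply: leq_weighted_count => u x; rewrite /absorb /P' /Q' /absorb.
  case: eqP => [->|_]; last by rewrite !muln1.
  rewrite mulnACA leq_mul2l; apply/orP; right.
  case: ifP => _; rewrite ?muln1 ?mul1n; first exact: sum_mul_rev_gt.
  by rewrite /G rev_ordK; apply: sum_mul_rev_le.
- exact: absd.
- by rewrite /Q'; case: ((v, w) \in o); [apply: (absd Q false)|apply: (absd Q true)].
(* On the alternating side nothing is lost: [v] and [w] lie in opposite classes, so the leaf sum
   equals [G (reflect2 v x)] whichever factor received [G]. *)
rewrite leq_eqVlt; apply/orP; left; apply/eqP/eq_weighted_count => u x.
rewrite /absorb /P' /Q' /absorb; case: eqP => [->|_]; last by rewrite !muln1.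
rewrite mulnACA; congr (_ * _).
have -> : (if (v, w) \in o then G (reflect2 v x) else 1) *
          (if (v, w) \in o then 1 else G (reflect2 v x)) = G (reflect2 v x).
  by case: ifP; rewrite ?muln1 ?mul1n.
rewrite (alternatingE vwe) /G /reflect2 (edgeP1 vwe).
case: (v \in P1); last by rewrite rev_ordK.
rewrite (reindex_inj rev_ord_inj) /=; apply: eq_bigl => y.
by case: x y => x xm [y ym] /=; lia.
Qed.

End AlternatingIsMaximal.

(** * Linear orders and strictly increasing maps *)

Lemma linear_orderP (T : finType) (A : {set T}) (c : {set T * T}) :
  reflect [/\ forall x y, (x, y) \in c -> x \in A /\ y \in A,
              forall x, (x, x) \notin c,
              forall x y z, (x, y) \in c -> (y, z) \in c -> (x, z) \in c &
              {in A &, forall x y, x != y -> (x, y) \in c \/ (y, x) \in c}]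
    (c \in linear_orders A).
Proof.
rewrite inE; apply: (iffP and4P) => -[sc ic tc oc]; split.
- by move=> x y /(subsetP sc); rewrite inE => /andP[].
- exact/forallP.
- move=> x y z xy yz.
  by have /forallP/(_ y)/forallP/(_ z) := forallP tc x; rewrite xy yz.
- move=> x y xA yA xy; have /forall_inP/(_ y yA) := forall_inP oc x xA.
  by rewrite xy => /orP.
- by apply/subsetP => -[x y] /sc[xA yA]; rewrite inE xA yA.
- exact/forallP.
- apply/forallP => x; apply/forallP => y; apply/forallP => z.
  by apply/implyP => xy; apply/implyP; apply: tc.
- apply/forall_inP => x xA; apply/forall_inP => y yA; apply/implyP => xy.
  exact/orP/oc.
Qed.

Lemma linear_order_asym (T : finType) (A : {set T}) (c : {set T * T}) x y :
  c \in linear_orders A -> (x, y) \in c -> (y, x) \notin c.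
Proof.
move=> /linear_orderP[_ ic tc _] xy; apply: contra (ic x) => yx.
exact: tc xy yx.
Qed.

Section IncreasingMaps.
Variable T : finType.
Implicit Types (o c : {set T * T}).

Definition increasing_maps m o : {set {ffun T -> 'I_m}} :=
  [set f | increasing_on setT o f].

Lemma increasing_mapsP m o (f : {ffun T -> 'I_m}) :
  reflect (forall x y, (x, y) \in o -> f x < f y) (f \in increasing_maps m o).
Proof.
rewrite inE; apply: (iffP (increasing_onP _ _ _)) => [H x y|H x y _ _]; last exact: H.
by apply: H; rewrite inE.
Qed.

Lemma card_increasing_maps m o :
  #|increasing_maps m o| = weighted_count setT o (fun _ (_ : 'I_m) => 1).
Proof.
rewrite /weighted_count -sum1dep_card big_mkcond; apply: eq_bigr => f _.
by rewrite big1 // muln1; case: increasing_on.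
Qed.

(** The increasing maps for [chain n] number C(m, n); only a lower bound for this number is
    needed. *)
Definition chain n : {set 'I_n * 'I_n} :=
  [set p : 'I_n * 'I_n | p.1 < p.2].

Definition order_rank c x := #|[set u | (u, x) \in c]|.

Lemma order_rank_lt c x y : c \in linear_orders setT ->
  (x, y) \in c -> order_rank c x < order_rank c y.
Proof.
move=> /linear_orderP[_ ic tc _] xy; apply: proper_card; apply/properP; split.
  by apply/subsetP => u; rewrite !inE => /tc; apply.
by exists x; rewrite inE.
Qed.

Lemma order_rank_max c x : c \in linear_orders setT -> order_rank c x < #|T|.
Proof.
move=> /linear_orderP[_ ic _ _]; rewrite -cardsT; apply: proper_card.
by apply/properP; split; [exact: subsetT|exists x; rewrite inE // ic].
Qed.

End IncreasingMaps.

(** The rank function is an order isomorphism from [c] onto the chain, and composition with it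
    matches the increasing maps. *)
Lemma card_increasing_linear (T : finType) (c : {set T * T}) m :
  c \in linear_orders setT ->
  #|increasing_maps m c| = #|increasing_maps m (chain #|T|)|.
Proof.
move=> cL; pose r x := Ordinal (order_rank_max x cL).
have [_ ic tc oc] := linear_orderP _ _ cL.
have r_lt x y : (r x < r y) = ((x, y) \in c).
  apply/idP/idP => [xy|]; last exact: order_rank_lt.
  case: (eqVneq x y) xy => [->|xy] rxy; first by rewrite ltnn in rxy.
  case: (oc x y _ _ xy); rewrite ?inE // => /(order_rank_lt cL) ryx.
  by move: (ltn_trans rxy ryx); rewrite ltnn.
have r_inj : injective r.
  move=> x y rxy; apply/eqP; apply: contraT => xy.
  by case: (oc x y _ _ xy); rewrite ?inE // -r_lt rxy ltnn.
have [q rK qK] : bijective r by apply: inj_card_bij; rewrite ?card_ord.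
pose h (g : {ffun 'I_#|T| -> 'I_m}) := [ffun x => g (r x)].
have h_inj : injective h.
  move=> g g' /ffunP E; apply/ffunP => i.
  by have := E (q i); rewrite !ffunE qK.
rewrite -(card_imset _ h_inj); apply: eq_card => f; apply/idP/imsetP.
  move=> /increasing_mapsP Hf; exists [ffun i => f (q i)].
    apply/increasing_mapsP => i j; rewrite inE !ffunE /= => ij.
    by apply: Hf; rewrite -r_lt !qK.
  by apply/ffunP => x; rewrite !ffunE rK.
case=> g /increasing_mapsP Hg ->; apply/increasing_mapsP => x y xy.
by rewrite !ffunE; apply: Hg; rewrite inE /= r_lt.
Qed.

(** An injective map pulls the order of its values back to a linear order, which extends [o] when
    the map is increasing. The fibre over [c] consists of all increasing maps for [c], and its size
    does not depend on [c]. *)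
Lemma card_injective_increasing (T : finType) (o : {set T * T}) m :
  #|[set f in increasing_maps m o | injectiveb f]| =
  sigma_orientation o * #|increasing_maps m (chain #|T|)|.
Proof.
pose X := [set f in increasing_maps m o | injectiveb f].
pose C := [set c in linear_orders [set: T] | o \subset c].
pose order_of (f : {ffun T -> 'I_m}) : {set T * T} := [set p | f p.1 < f p.2].
have order_ofC f : f \in X -> order_of f \in C.
  rewrite inE => /andP[/increasing_mapsP Hf /injectiveP f_inj]; rewrite inE.
  apply/andP; split; last by apply/subsetP => -[x y] xy; rewrite inE; apply: Hf.
  apply/linear_orderP; split=> [x y _|x|x y z|x y _ _ xy]; rewrite ?inE //=.
  - by rewrite ltnn.
  - exact: ltn_trans.
  - by apply/orP; rewrite -neq_ltn; apply: contra xy => /eqP/val_inj/f_inj->.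
rewrite -/X -sum1_card (partition_big order_of (mem C)) //=.
rewrite /sigma_orientation -/C -sum_nat_const; apply: eq_bigr => c.
rewrite inE => /andP[cL oc]; rewrite -(card_increasing_linear m cL) -sum1_card.
apply: eq_bigl => f; have [_ ic tc tot] := linear_orderP _ _ cL.
apply/andP/increasing_mapsP => [[_ /eqP<- x y]|Hf]; first by rewrite inE.
have f_inj : injective f.
  move=> x y fxy; apply/eqP; apply: contraT => xy.
  by case: (tot x y _ _ xy); rewrite ?inE // => /Hf; rewrite fxy ltnn.
split.
  rewrite inE; apply/andP; split; last exact/injectiveP.
  by apply/increasing_mapsP => x y /(subsetP oc)/Hf.
apply/eqP/setP => -[x y]; rewrite inE /=; apply/idP/idP => [fxy|]; last exact: Hf.
have xy : x != y by apply: contraTneq fxy => ->; rewrite ltnn.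
case: (tot x y _ _ xy); rewrite ?inE // => /Hf fyx.
by move: (ltn_trans fxy fyx); rewrite ltnn.
Qed.

(** Position [i] is sent into the [i]-th of [n] consecutive blocks of length [k], the place inside
    the block being free. *)
Lemma card_increasing_chain_ge n k m : n * k <= m ->
  k ^ n <= #|increasing_maps m (chain n)|.
Proof.
move=> nkm.
have lt_m (h : {ffun 'I_n -> 'I_k}) (i : 'I_n) : i * k + h i < m.
  apply: leq_trans nkm; have := leq_mul (ltn_ord i) (leqnn k).
  by apply: leq_trans; rewrite mulSn addnC ltn_add2r.
pose b (h : {ffun 'I_n -> 'I_k}) := [ffun i => Ordinal (lt_m h i)].
have b_inj : injective b.
  move=> h h' /ffunP E; apply/ffunP => i; apply/val_inj.
  by have := congr1 val (E i); rewrite !ffunE /= => /addnI.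
have -> : k ^ n = #|{ffun 'I_n -> 'I_k}| by rewrite card_ffun !card_ord.
rewrite -(card_imset _ b_inj); apply/subset_leq_card/subsetP => _ /imsetP[h _ ->].
apply/increasing_mapsP => i j; rewrite inE !ffunE /= => ij.
have := leq_mul ij (leqnn k); rewrite mulSn => le.
apply: leq_trans (leq_addr _ _); apply: leq_trans le.
by rewrite addnC ltn_add2r.
Qed.

(** Union bound over the pairs of distinct points: by [sum_update], a given pair receives equal
    values in exactly one [m]-th of all maps. *)
Lemma card_not_injective_le (T : finType) m :
  m * #|[set f : {ffun T -> 'I_m} | ~~ injectiveb f]| <= #|T| ^ 2 * m ^ #|T|.
Proof.
pose E (p : T * T) := [set f : {ffun T -> 'I_m} | f p.1 == f p.2].
have cE p : p.1 != p.2 -> m * #|E p| = m ^ #|T|.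
  move=> p12; rewrite -sum1dep_card big_mkcond /= -{1}(card_ord m).
  have -> : m ^ #|T| = #|{ffun T -> 'I_m}| by rewrite card_ffun card_ord.
  rewrite -(sum_update _ p.2) -sum1_card.
  apply: eq_bigr => f _; rewrite (bigD1 (f p.1)) //=.
  rewrite update_other // update_same eqxx big1 // => y.
  by rewrite update_other // update_same eq_sym => /negPf->.
apply: leq_trans (_ : \sum_(p : T * T | p.1 != p.2) m * #|E p| <= _).
  rewrite -big_distrr leq_mul2l /=; apply/orP; right.
  rewrite -sum1dep_card; under [leqRHS]eq_bigr => p _ do rewrite -sum1dep_card.
  rewrite (exchange_big_dep xpredT) //= big_mkcond; apply: leq_sum => f _.
  case: ifP => // /injectivePn[x [y xy fxy]].
  by rewrite (bigD1 (x, y)) //= xy fxy eqxx.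
rewrite (eq_bigr _ cE) sum_nat_const leq_mul2r; apply/orP; right.
by rewrite (leq_trans (max_card _)) // card_prod.
Qed.

(** * The maximum is attained at the alternating orientation *)

Section SigmaAlternating.
Variables (T : finType) (e : rel T) (P1 P2 : {set T}).
Hypotheses (e_tree : is_tree e) (P12 : principal_decomposition e P1 P2).

Lemma sigma_orientation_le_alternating o : o \in orientations e ->
  sigma_orientation o <= sigma_orientation (alternating e P1 P2).
Proof.
move=> oE; have [e_sym e_irr _ e_acyc] := e_tree.
(* k is chosen so that the k^n increasing maps which send the i-th vertex into
   the i-th block of length k outnumber all noninjective maps. *)
set n := #|T|; pose k := (n ^ 2 * n.+1 ^ n).+1; pose m := n.+1 * k.
have m0 : 0 < m by [].
set a := alternating e P1 P2; set F := #|increasing_maps m (chain n)|.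
pose N := #|[set f : {ffun T -> 'I_m} | ~~ injectiveb f]|.
have le_oa : #|increasing_maps m o| <= #|increasing_maps m a|.
  rewrite !card_increasing_maps.
  exact: (weighted_count_le_alternating e_sym e_irr e_acyc P12 setT
    (P := fun _ _ => 1) (Q := fun _ _ => 1) m0 oE).
have lo : sigma_orientation o * F <= #|increasing_maps m o|.
  rewrite -card_injective_increasing; apply/subset_leq_card/subsetP => f.
  by rewrite inE => /andP[].
have up : #|increasing_maps m a| <= sigma_orientation a * F + N.
  rewrite -card_injective_increasing.
  rewrite -(cardsID [set f : {ffun T -> 'I_m} | injectiveb f]); apply: leq_add.
    by apply/subset_leq_card/subsetP => f; rewrite !inE => /andP[-> ->].
  by apply/subset_leq_card/subsetP => f; rewrite !inE => /andP[-> _].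
(* The chain is [m * N <= n^2 * m^n = n^2 * n.+1^n * k^n < k * k^n <= m * k^n <= m * F]. *)
have NF : N < F.
  rewrite -(ltn_pmul2l m0); apply: leq_ltn_trans (card_not_injective_le T m) _.
  have : k ^ n <= F by apply: card_increasing_chain_ge; rewrite leq_mul2r leqnSn orbT.
  rewrite -(leq_pmul2l m0); apply: leq_trans.
  rewrite expnMn mulnA /m -mulnA mulnA mulnC -/n.
  rewrite -[X in _ < X]mulnA -expnS -/k.
  apply: leq_trans (_ : k ^ n * k <= _); first by rewrite ltn_pmul2l ?expn_gt0.
  by rewrite -expnSr leq_pmull.
(* Writing s for [sigma_orientation]: [s o * F <= s a * F + N < (s a).+1 * F], and [F] cancels. *)
rewrite -ltnS -(ltn_pmul2r (leq_trans (ltn0Sn _) NF)).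
by apply: leq_ltn_trans (leq_trans lo (leq_trans le_oa up)) _; rewrite mulSn addnC ltn_add2r.
Qed.

Lemma sigma_alternating : sigma e = sigma_orientation (alternating e P1 P2).
Proof.
apply/eqP; rewrite eqn_leq; apply/andP; split.
  by apply/bigmax_leqP => o; apply: sigma_orientation_le_alternating.
have [e_sym e_irr _ _] := e_tree.
by apply: (leq_bigmax_cond (F := @sigma_orientation T)); apply: alternating_orientation.
Qed.

End SigmaAlternating.

(** * The hook length formula for forests *)

Section HookFormula.
Variable T : finType.
Implicit Types (A : {set T}) (c : {set T * T}) (G : T -> {set T}).

Definition is_min A c r : bool := [forall u in A :\ r, (r, u) \in c].

Lemma linear_order_min A c : c \in linear_orders A -> A != set0 ->
  exists2 r, r \in A & is_min A c r.
Proof.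
move=> /linear_orderP[_ ic tc tot] /set0Pn[x0 x0A].
pose above x := #|[set u | (x, u) \in c]|.
have [r rA rmax] := arg_maxnP above x0A.
exists r => //; apply/forall_inP => u /setD1P[ur uA].
have [//|ru] := tot u r uA rA ur; last by [].
move=> /= ur'; have : above u <= above r := rmax u uA; rewrite leqNgt => /negP[].
apply: proper_card; apply/properP; split.
  by apply/subsetP => z; rewrite !inE; apply: tc.
by exists r; rewrite inE // ic.
Qed.

(** This encodes a forest on [A] by its subtrees: [G v] is [v] together with its descendants. *)
Definition laminar A G : Prop :=
  [/\ {in A, forall v, v \in G v /\ G v \subset A},
      {in A &, forall v w, w \in G v -> G w \subset G v},
      {in A &, forall v w, [|| w \in G v, v \in G w | [disjoint G v & G w]]} &
      {in A &, forall v w, w \in G v -> v \in G w -> v = w}].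

(** These are the linear extensions of the forest order, ancestors coming first. *)
Definition min_orders A G : {set {set T * T}} :=
  [set c in linear_orders A | [forall v in A, is_min (G v) c v]].

Lemma min_ordersP A G c :
  reflect (c \in linear_orders A /\ {in A, forall v, is_min (G v) c v})
    (c \in min_orders A G).
Proof.
by rewrite [X in reflect _ X]in_set; apply: (iffP andP) => -[cL /forall_inP cmin]; split=> //; exact/forall_inP.
Qed.

Definition is_root A G r : bool := [forall v in A, (r \in G v) ==> (v == r)].

Lemma laminar_setD1 A G r : laminar A G -> is_root A G r -> laminar (A :\ r) G.
Proof.
case=> GA Gs Gd Ga /forall_inP r_root; split.
- move=> v /setD1P[vr vA]; have [vv vs] := GA v vA; split=> //.
  apply/subsetP => u uv; rewrite !inE (subsetP vs) // andbT.
  by apply: contraNneq vr => ur; have := r_root v vA; rewrite -ur uv.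
- by move=> v w /setD1P[_ ?] /setD1P[_ ?]; apply: Gs.
- by move=> v w /setD1P[_ ?] /setD1P[_ ?]; apply: Gd.
- by move=> v w /setD1P[_ ?] /setD1P[_ ?]; apply: Ga.
Qed.

(** The trees hanging from the roots partition [A]: a largest [G v] containing [x] belongs to a
    root, and distinct roots have disjoint trees. *)
Lemma card_laminar A G : laminar A G -> #|A| = \sum_(r in A | is_root A G r) #|G r|.
Proof.
case=> GA Gs Gd Ga.
rewrite -sum1_card; under [RHS]eq_bigr do rewrite -sum1_card.
rewrite (exchange_big_dep (mem A)) /=; last first.
  by move=> r x /andP[rA _]; apply/subsetP; case: (GA r rA).
apply: eq_bigr => x xA; have [xx _] := GA x xA.
have [r /andP[rA xr] rmax] := @arg_maxnP _ x (fun v => (v \in A) && (x \in G v))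
  (fun v => #|G v|) (introT andP (conj xA xx)).
have r_root : is_root A G r.
  apply/forall_inP => v vA; apply/implyP => rv; apply/eqP.
  have sub := Gs v r vA rA rv.
  apply: Ga => //; have [vv _] := GA v vA.
  have /eqP-> // : G r == G v.
  by rewrite eqEcard sub; apply: rmax; rewrite vA (subsetP sub).
rewrite (bigD1 r) /= ?rA ?r_root // big1 // => s /andP[/andP[/andP[sA sroot] xs] sr].
case/or3P: (Gd r s rA sA) => [srG|rsG|].
- by have := forall_inP sroot r rA; rewrite srG eq_sym (negPf sr).
- by have := forall_inP r_root s sA; rewrite rsG (negPf sr).
- by rewrite disjoint_subset => /subsetP/(_ x xr); rewrite inE xs.
Qed.

(** Adjoining [r] as least element is inverse to deleting it. Being a root, [r] lies in no [G v]
    with [v != r], so the other constraints are unaffected. *)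
Lemma card_min_orders_min A G r : laminar A G -> r \in A -> is_root A G r ->
  #|[set c in min_orders A G | is_min A c r]| = #|min_orders (A :\ r) G|.
Proof.
move=> lam rA r_root; have [GA Gs Gd Ga] := lam.
have [GA' _ _ _] := laminar_setD1 lam r_root.
pose h c := c :|: setX [set r] (A :\ r).
have hE c x y : ((x, y) \in h c) = ((x, y) \in c) || [&& x == r, y != r & y \in A].
  by rewrite !inE.
have h_inj : {in min_orders (A :\ r) G &, injective h}.
  move=> c c' /min_ordersP[/linear_orderP[s _ _ _] _].
  move=> /min_ordersP[/linear_orderP[s' _ _ _] _] /setP E; apply/setP => -[x y].
  have := E (x, y); rewrite !hE; case: (eqVneq x r) => [->|_]; last by rewrite !orbF.
  by move=> _; apply/idP/idP => [/s|/s'] []; rewrite !inE eqxx.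
rewrite -(card_in_imset h_inj); apply: eq_card => c; apply/idP/imsetP; last first.
  move=> [c' /min_ordersP[/linear_orderP[s ic tc tot] cmin] ->].
  have sr x y : (x, y) \in c' -> [/\ x != r, x \in A, y != r & y \in A].
    by move=> /s; rewrite !inE => -[/andP[-> ->] /andP[-> ->]].
  have rmin : is_min A (h c') r.
    by apply/forall_inP => u /setD1P[ur uA]; rewrite hE eqxx ur uA orbT.
  rewrite inE rmin andbT; apply/min_ordersP; split; first apply/linear_orderP; first split.
  - move=> x y; rewrite hE => /orP[/sr[]|/and3P[/eqP->]] //.
  - by move=> x; rewrite hE negb_or ic /=; case: eqP.
  - move=> x y z; rewrite !hE => /orP[xy|/and3P[/eqP-> yr yA]].
      case/orP=> [yz|/and3P[/eqP yr]]; first by rewrite (tc _ _ _ xy yz).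
      by case: (sr _ _ xy); rewrite yr eqxx.
    case/orP=> [yz|/and3P[/eqP yr']]; last by rewrite yr' eqxx in yr.
    by case: (sr _ _ yz) => _ _ -> ->; rewrite eqxx orbT.
  - move=> x y xA yA xy; rewrite !hE; case: (eqVneq x r) => [xr|xr].
      by left; rewrite -xr eq_sym xy yA orbT.
    case: (eqVneq y r) => [yr|yr]; first by right; rewrite xA orbT.
    by rewrite /= !orbF; apply: tot; rewrite ?inE ?xr ?yr.
  move=> v vA; apply/forall_inP => u /setD1P[uv uG]; rewrite hE.
  case: (eqVneq v r) => [vr|vr].
    by rewrite -vr uv (subsetP (GA v vA).2) ?orbT.
  have vAr : v \in A :\ r by rewrite !inE vr.
  by rewrite (forall_inP (cmin v vAr)) // !inE uv.
rewrite inE => /andP[/min_ordersP[cL cmin] /forall_inP rmin].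
have [s ic tc tot] := linear_orderP _ _ cL.
have cr x : (x, r) \notin c.
  apply/negP => xr; have [xA _] := s _ _ xr.
  have xNr : x != r by apply: contraTneq xr => ->.
  by have := linear_order_asym cL xr; rewrite rmin // !inE xNr.
exists (c :&: setX (A :\ r) (A :\ r)).
  apply/min_ordersP; split; first apply/linear_orderP; first split.
  - by move=> x y; rewrite inE => /andP[_]; rewrite in_setX => /andP[].
  - by move=> x; rewrite inE (negPf (ic x)).
  - move=> x y z; rewrite !in_setI !in_setX => /and3P[xy -> _] /and3P[yz _ ->].
    by rewrite (tc _ _ _ xy yz).
  - move=> x y xA yA xy; rewrite !in_setI !in_setX xA yA !andbT.
    by apply: tot => //; [case/setD1P: xA|case/setD1P: yA].
  move=> v vA; apply/forall_inP => u /setD1P[uv uG].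
  have vA' : v \in A by case/setD1P: vA.
  rewrite in_setI in_setX vA (subsetP (GA' v vA).2) // !andbT.
  by rewrite (forall_inP (cmin v vA')) // !inE uv.
apply/setP => -[x y]; rewrite hE in_setI in_setX !inE.
apply/idP/idP => [xy|/orP[/and3P[]//|/and3P[/eqP-> yr yA]]].
  have [xA yA] := s _ _ xy; rewrite xy xA yA /= !andbT.
  have -> : y != r by apply: contraTneq xy => ->.
  by case: eqP.
by apply: rmin; rewrite !inE yr.
Qed.

(** The least element of a linear extension is a root, so the extensions are sorted by it. Removing
    the root [r] leaves a term [#|G r| * (#|A| - 1)!] by induction, and the sizes [#|G r|] add up to
    [#|A|]. *)
Lemma hook_formula A G : laminar A G ->
  #|min_orders A G| * \prod_(v in A) #|G v| = #|A|`!.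
Proof.
have [k] := ubnP #|A|; elim: k A => // k IHk A Ak lam.
case: (eqVneq A set0) => [A0|An0].
  rewrite A0 big_set0 cards0 muln1; apply/eqP/cards1P; exists set0.
  apply/setP => c; rewrite in_set1; apply/min_ordersP/eqP => [[]|->].
    move=> /linear_orderP[s _ _ _] _; apply/setP => -[x y]; rewrite inE.
    by apply/negP => /s[]; rewrite inE.
  split; last by move=> v; rewrite inE.
  by apply/linear_orderP; split=> [x y|x|x y z|x y]; rewrite inE.
have -> : #|min_orders A G| =
    \sum_(r in A | is_root A G r) #|min_orders (A :\ r) G|.
  rewrite -sum1_card; under [RHS]eq_bigr => r /andP[rA rr].
    by rewrite -(card_min_orders_min lam rA rr) -sum1_card; over.
  rewrite [RHS](exchange_big_dep (mem (min_orders A G))) /=; last first.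
    by move=> r c _; rewrite inE => /andP[].
  apply: eq_bigr => c cM; have /min_ordersP[cL cmin] := cM.
  have [r rA rmin] := linear_order_min cL An0.
  have r_root : is_root A G r.
    apply/forall_inP => v vA; apply/implyP => rv; apply: contraT => vr.
    have := linear_order_asym cL (forall_inP (cmin v vA) r _).
    by rewrite !inE eq_sym vr rv => /(_ isT); rewrite (forall_inP rmin) // !inE vr.
  have cS : c \in [set c in min_orders A G | is_min A c r] by rewrite in_set cM.
  rewrite (bigD1 r) /=; last by rewrite rA r_root cS.
  rewrite big1 // => s /andP[/andP[/andP[sA _]]].
  rewrite inE => /andP[_ smin] sr.
  have := linear_order_asym cL (forall_inP smin r _).
  by rewrite !inE eq_sym sr rA => /(_ isT); rewrite (forall_inP rmin) // !inE sr.
rewrite big_distrl /=.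
rewrite (eq_bigr (fun r => #|G r| * #|A|.-1`!)); last first.
  move=> r /andP[rA rr]; rewrite (big_setD1 r) //= mulnCA IHk.
  - by rewrite (cardsD1 r A) rA.
  - by rewrite (cardsD1 r) rA in Ak.
  - exact: laminar_setD1.
rewrite -big_distrl /= -(card_laminar lam).
by move: An0; rewrite -card_gt0; case: #|A| => // n _; rewrite factS.
Qed.

End HookFormula.

(** * The components attached to an order of [P1], and the orders extending the alternating
    orientation *)

Section Components.
Variables (T : finType) (e : rel T) (P1 : {set T}).
Hypothesis e_sym : symmetric e.
Implicit Types (d c : {set T * T}) (v w u x y : T).

Definition unremoved d v : {set T} := [set: T] :\: [set w in P1 | (w, v) \in d].

Lemma in_unremoved d v x : (x \in unremoved d v) = ~~ ((x \in P1) && ((x, v) \in d)).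
Proof. by rewrite !inE andbT. Qed.

Lemma in_Gamma d v u : (u \in Gamma_ e P1 d v) =
  connect [rel x y | [&& x \in unremoved d v, y \in unremoved d v & e x y]] v u.
Proof. by rewrite inE. Qed.

Lemma Gamma_self d v : v \in Gamma_ e P1 d v.
Proof. by rewrite in_Gamma. Qed.

Lemma Gamma_pred d v u : u \in Gamma_ e P1 d v -> u != v ->
  exists2 x, x \in Gamma_ e P1 d v & (u \in unremoved d v) && e x u.
Proof.
rewrite in_Gamma => /connectP[p]; case/lastP: p => [_ -> /eqP//|p z].
rewrite rcons_path last_rcons => /andP[vp /and3P[_ zS ez]] -> _.
by exists (last v p); [rewrite in_Gamma; apply/connectP; exists p|rewrite zS].
Qed.

Lemma Gamma_ind d v (X : {set T}) : v \in X ->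
  (forall x y, x \in Gamma_ e P1 d v -> x \in X -> y \in unremoved d v ->
     e x y -> y \in X) ->
  Gamma_ e P1 d v \subset X.
Proof.
move=> vX step; apply/subsetP => u; rewrite in_Gamma => /connectP[p].
elim/last_ind: p u => [|p z IHp] u; first by move=> _ ->.
rewrite rcons_path last_rcons => /andP[vp /and3P[_ zS ez]] ->.
apply: step (IHp _ vp erefl) zS ez.
by rewrite in_Gamma; apply/connectP; exists p.
Qed.

Lemma unremoved_connect_sym d v :
  connect_sym [rel x y | [&& x \in unremoved d v, y \in unremoved d v & e x y]].
Proof. by apply: sym_connect_sym => x y /=; rewrite e_sym andbCA. Qed.

Section LinearOrder.
Variable d : {set T * T}.
Hypothesis dL : d \in linear_orders P1.

Lemma unremoved_self v : v \in unremoved d v.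
Proof. by have [_ ic _ _] := linear_orderP _ _ dL; rewrite in_unremoved (negPf (ic v)) andbF. Qed.

Lemma Gamma_unremoved d' v : v \in unremoved d' v -> Gamma_ e P1 d' v \subset unremoved d' v.
Proof. by move=> vS; apply: Gamma_ind. Qed.

Lemma Gamma_step d' v x y : v \in unremoved d' v -> x \in Gamma_ e P1 d' v ->
  y \in unremoved d' v -> e x y -> y \in Gamma_ e P1 d' v.
Proof.
move=> vS xG yS xy; have xS := subsetP (Gamma_unremoved vS) x xG.
rewrite in_Gamma in xG; rewrite in_Gamma; apply: connect_trans xG (connect1 _).
by rewrite /= xS yS.
Qed.

Lemma unremoved_mono v w : (v, w) \in d -> unremoved d w \subset unremoved d v.
Proof.
have [_ _ tc _] := linear_orderP _ _ dL => vw; apply/subsetP => x.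
rewrite !in_unremoved; apply: contra => /andP[-> xv] /=.
exact: tc xv vw.
Qed.

Lemma unremoved_connect v w : unremoved d w \subset unremoved d v ->
  subrel (connect [rel x y | [&& x \in unremoved d w, y \in unremoved d w & e x y]])
         (connect [rel x y | [&& x \in unremoved d v, y \in unremoved d v & e x y]]).
Proof.
move=> /subsetP sub; apply: connect_sub => x y /= /and3P[xS yS xy].
by apply: connect1; rewrite /= !sub.
Qed.

Lemma Gamma_P1 v w : v \in P1 -> w \in P1 -> w \in Gamma_ e P1 d v ->
  w != v -> (v, w) \in d.
Proof.
have [_ _ _ tot] := linear_orderP _ _ dL => vP wP wG wv.
have := subsetP (Gamma_unremoved (unremoved_self v)) w wG.
by rewrite in_unremoved wP /=; case: (tot w v wP vP wv) => ->.
Qed.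

Lemma Gamma_mono v w : (v, w) \in d -> w \in Gamma_ e P1 d v ->
  Gamma_ e P1 d w \subset Gamma_ e P1 d v.
Proof.
move=> /unremoved_mono/unremoved_connect sub; rewrite in_Gamma => vw.
by apply/subsetP => u; rewrite !in_Gamma => /sub; apply: connect_trans.
Qed.

(** Singletons outside [P1] impose no constraint and have hook length 1, which makes a forest on all
    of [T]. *)
Definition hook v : {set T} := if v \in P1 then Gamma_ e P1 d v else [set v].

(** If [v] precedes [w] in [d], the graph left for [w] is a subgraph of the one left for [v], so its
    component either lies inside that of [v] or is disjoint from it. *)
Lemma hook_laminar : laminar [set: T] hook.
Proof.
rewrite /hook; split.
- move=> v _; split; last exact: subsetT.
  by case: ifP => _; rewrite ?Gamma_self ?set11.
- move=> v w _ _; case: (boolP (v \in P1)) => vP; last by rewrite inE => /eqP->; rewrite (negPf vP).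
  case: ifP => wP wG; last by rewrite sub1set.
  case: (eqVneq w v) => [->//|wv].
  exact: Gamma_mono (Gamma_P1 vP wP wG wv) wG.
- move=> v w _ _; case: (boolP (v \in P1)) => vP; last first.
    by rewrite disjoints1; case: (v \in _); rewrite ?orbT.
  case: (boolP (w \in P1)) => wP; last first.
    by rewrite (disjoint_sym (mem (Gamma_ _ _ _ _))) disjoints1; case: (w \in _); rewrite ?orbT.
  have common x y z : (x, y) \in d -> z \in Gamma_ e P1 d x -> z \in Gamma_ e P1 d y ->
      y \in Gamma_ e P1 d x.
    move=> xy; rewrite !in_Gamma => xz /(unremoved_connect (unremoved_mono xy)).
    by rewrite unremoved_connect_sym => zy; apply: connect_trans xz zy.
  case: (boolP [disjoint _ & _]); rewrite ?orbT // => /pred0Pn[z /andP[/= zv zw]].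
  rewrite orbF; case: (eqVneq v w) => [->|vw]; first by rewrite Gamma_self.
  have [_ _ _ tot] := linear_orderP _ _ dL.
  case: (tot v w vP wP vw) => dvw; first by rewrite (common _ _ z dvw).
  by rewrite (common _ _ z dvw) ?orbT.
- move=> v w _ _; case: (boolP (v \in P1)) => vP; last by rewrite inE => /eqP.
  case: ifP => wP wG; last by rewrite inE => /eqP.
  move=> vG; apply/eqP; apply: contraT => vw.
  have := linear_order_asym dL (Gamma_P1 wP vP vG vw).
  by rewrite (Gamma_P1 vP wP wG) // eq_sym.
Qed.

End LinearOrder.

Variable P2 : {set T}.
Hypothesis P12 : principal_decomposition e P1 P2.

Definition restrict c : {set T * T} := c :&: setX P1 P1.

Lemma restrict_linear c : c \in linear_orders setT -> restrict c \in linear_orders P1.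
Proof.
move=> /linear_orderP[_ ic tc tot]; apply/linear_orderP; split.
- by move=> x y; rewrite inE in_setX => /and3P[].
- by move=> x; rewrite inE (negPf (ic x)).
- move=> x y z; rewrite !in_setI !in_setX => /and3P[xy -> _] /and3P[yz _ ->].
  by rewrite (tc _ _ _ xy yz).
- by move=> x y xP yP xy; rewrite !in_setI !in_setX xP yP !andbT; apply: tot.
Qed.

Lemma alternating_hook c d : c \in linear_orders setT -> d \in linear_orders P1 ->
  (alternating e P1 P2 \subset c) && ord_equiv e P1 d (restrict c) =
  (c \in min_orders setT (hook d)).
Proof.
move=> cL dL; have d'L := restrict_linear cL.
have [_ ic tc tot] := linear_orderP _ _ cL.
apply/andP/min_ordersP => [[alt /forall_inP eqG]|[_ cmin]]; last first.
  have vmin v u : v \in P1 -> u \in Gamma_ e P1 d v -> u != v -> (v, u) \in c.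
    move=> vP uG uv; have := forall_inP (cmin v (in_setT v)) u.
    by rewrite /hook vP => -> //; rewrite in_setD1 uv.
  split.
    apply/subsetP => -[v u]; rewrite inE /= => /and3P[vu vP].
    rewrite (P2E P12) => uP; apply: vmin => //; last by apply: contraNneq uP => ->.
    apply: Gamma_step (unremoved_self dL v) (Gamma_self _ _) _ vu.
    by rewrite in_unremoved (negPf uP).
  apply/forall_inP => v vP; rewrite eqEsubset; apply/andP; split.
    (* Vertices of the component for [d] other than [v] are above [v] in [c], so [restrict c]
       removes none of them. *)
    apply: Gamma_ind (Gamma_self _ _) _ => x y xG xG' yS xy.
    have yG := Gamma_step (unremoved_self dL v) xG yS xy.
    apply: Gamma_step (unremoved_self d'L v) xG' _ xy.
    rewrite in_unremoved negb_and inE orbC; apply/orP; left.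
    rewrite negb_and; apply/orP; left.
    case: (eqVneq y v) => [->//|yv]; exact: linear_order_asym cL (vmin _ _ vP yG yv).
  apply: Gamma_ind (Gamma_self _ _) _ => x y xG' xG yS' xy.
  case: (boolP (y \in unremoved d v)) => yS.
    exact: Gamma_step (unremoved_self dL v) xG yS xy.
  (* If [d] removed [y], then [y] would precede [v] in [d] and reach [v] through [x]. So [v] would
     lie in the component of [y], minimality would put [y] below [v] in [c], and [restrict c] would
     remove [y] too. *)
  move: yS; rewrite in_unremoved negbK => /andP[yP yv].
  have sub := unremoved_mono dL yv.
  have vG : v \in Gamma_ e P1 d y.
    have xS := subsetP (Gamma_unremoved (unremoved_self dL v)) x xG.
    have yxG : x \in Gamma_ e P1 d y.
      apply: Gamma_step (unremoved_self dL y) (Gamma_self _ _) (subsetP sub x xS) _.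
      by rewrite e_sym.
    move: xG yxG; rewrite !in_Gamma => /(unremoved_connect sub).
    by rewrite unremoved_connect_sym => xv yx; apply: connect_trans yx xv.
  have [_ id _ _] := linear_orderP _ _ dL.
  have vy : v != y by apply: contraTneq yv => ->.
  move: yS'; rewrite in_unremoved in_setI in_setX yP vP andbT /=.
  by rewrite (vmin y v yP vG vy).
split=> // v _; rewrite /hook; case: ifP => vP; apply/forall_inP => u /setD1P[uv]; last first.
  by rewrite inE (negPf uv).
rewrite (eqP (eqG v vP)) => uG.
have vP1 w : w \in P1 -> w \in Gamma_ e P1 (restrict c) v -> w != v -> (v, w) \in c.
  by move=> wP wG wv; have := Gamma_P1 d'L vP wP wG wv; rewrite inE => /andP[].
case: (boolP (u \in P1)) => uP; first exact: vP1.
(* A vertex of [P2] in the component is entered from a neighbour in [P1], which is [v] or above [v],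
   and the alternating orientation puts it above that neighbour. *)
have [x xG /andP[_ xu]] := Gamma_pred uG uv.
have xP : x \in P1 by have := edgeP1 P12 xu; rewrite (negPf uP) => /esym/negbFE.
have xuc : (x, u) \in c.
  by apply: (subsetP alt); rewrite inE /= xu xP (P2E P12).
by case: (eqVneq x v) => [<-//|xv]; apply: tc (vP1 x xP xG xv) xuc.
Qed.

(** The linear orders extending the alternating orientation are sorted by the class of their
    restriction to [P1]; [alternating_hook] describes each fibre through any representative. *)
Lemma sigma_alternating_classes (rep : {set {set T * T}} -> {set T * T}) :
  (forall D, D \in ord_classes e P1 -> rep D \in D) ->
  sigma_orientation (alternating e P1 P2) =
  \sum_(D in ord_classes e P1) #|min_orders setT (hook (rep D))|.
Proof.
move=> repD; have part := equivalence_partitionP (@ord_equiv_rel T e P1).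
have /and3P[/eqP cov triv _] := part.
rewrite /sigma_orientation -sum1_card.
rewrite (partition_big (fun c => pblock (ord_classes e P1) (restrict c))
  (mem (ord_classes e P1))) /=; last first.
  move=> c; rewrite in_set => /andP[cL _]; apply: pblock_mem.
  by rewrite cov; apply: restrict_linear.
apply: eq_bigr => D DC; rewrite sum1dep_card; apply: eq_card => c; rewrite 2![in LHS]in_set.
case: (boolP (c \in linear_orders setT)) => [cL|cN] /=; last first.
  by apply/esym/negbTE; apply: contra cN => /min_ordersP[].
have dL : rep D \in linear_orders P1.
  by rewrite -cov; apply/bigcupP; exists D => //; apply: repD.
rewrite -(alternating_hook cL dL); congr (_ && _).
have restrL := restrict_linear cL.
rewrite -[X in _ == X](def_pblock triv DC (repD D DC)) eq_sym eq_pblock ?cov //.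
by rewrite (pblock_equivalence_partition (@ord_equiv_rel T e P1)).
Qed.

End Components.

(** * The formula over the rationals *)

Import GRing.Theory.
Local Open Scope ring_scope.

Theorem theorem4p1 (T : finType) (e : rel T) (P1 P2 : {set T})
    (rep : {set {set T * T}} -> {set T * T}) :
  is_tree e ->
  principal_decomposition e P1 P2 ->
  (forall D : {set {set T * T}}, D \in ord_classes e P1 -> rep D \in D) ->
  (sigma e)%:R =
  (#|T|`!)%:R *
    \sum_(D in ord_classes e P1)
      1 / \prod_(v in P1) (#|Gamma_ e P1 (rep D) v|)%:R :> rat.
Proof.
move=> e_tree P12 repD; have [e_sym _ _ _] := e_tree.
rewrite (sigma_alternating e_tree P12) (sigma_alternating_classes e_sym P12 repD).
rewrite natr_sum mulr_sumr; apply: eq_bigr => D DC.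
have dL : rep D \in linear_orders P1.
  have /and3P[/eqP <- _ _] := equivalence_partitionP (@ord_equiv_rel T e P1).
  by apply/bigcupP; exists D => //; apply: repD.
have := hook_formula (hook_laminar e_sym dL).
(* Hooks outside [P1] are singletons, so only the factors over [P1] remain. *)
rewrite cardsT (bigID (mem P1)) /= [X in (_ * (_ * X))%N]big1 ?muln1; last first.
  by move=> v /andP[_ /negPf vP]; rewrite /hook vP cards1.
rewrite (eq_bigl (mem P1)) => [|v]; last by rewrite in_setT.
rewrite (eq_bigr (fun v => #|Gamma_ e P1 (rep D) v|)) => [<-|v vP]; last first.
  by move: vP; rewrite /hook /= => ->.
rewrite natrM natr_prod div1r mulfK //; apply/prodf_neq0 => v _.
rewrite Num.Theory.pnatr_eq0 -lt0n; apply/card_gt0P; exists v; exact: Gamma_self.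
Qed.
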